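(* Let $d\ge2$ and consider the nearest neighbor ferromagnetic Ising model on $\mathbb{Z}^d$ at zero magnetic field and inverse temperature $0\le\beta<\beta_c$. Let $\mu>0$ be a constant for which the two-point exponential decay $\langle\sigma_x\sigma_y\rangle_\beta\le e^{-\mu|x-y|}$ holds for all $x,y\in\mathbb{Z}^d$. Then there is a constant $C_{d,\mu}>0$ such that for every $n\ge1$ and every subset $A\subset\mathbb{Z}^d$ with $|A|=2n$, $$\langle\sigma_A\rangle_\beta\le C_{d,\mu}^n\,e^{-\frac{\mu}{2\sqrt d}D_s(A)}.$$
   Context: Ising model: for a finite $\Lambda\subset\mathbb{Z}^d$, with spins $\sigma_x=\pm1$, $x\in\Lambda$, the zero-field Hamiltonian is $H(\sigma)=-\frac12\sum_{\{x,y\}\subset\Lambda}J_{x,y}\sigma_x\sigma_y$ with $J_{x,y}=1$ if $|x-y|=1$ and $J_{x,y}=0$ otherwise. The Gibbs expectation is $\langle f\rangle_{\Lambda,\beta}=\mathrm{tr}_\Lambda(f(\sigma)e^{-\beta H(\sigma)})/Z_\Lambda(\beta)$, where $\mathrm{tr}_\Lambda=\prod_{x\in\Lambda}\frac12\sum_{\sigma_x=\pm1}$ and $Z_\Lambda(\beta)=\mathrm{tr}_\Lambda e^{-\beta H(\sigma)}$. For $A\subset\Lambda$, $\sigma_A:=\prod_{x\in A}\sigma_x$. The functions $\langle\sigma_A\rangle_{\Lambda,\beta}$ increase in $\Lambda$, and $\langle\cdot\rangle_\beta$ denotes the limit as $\Lambda\uparrow\mathbb{Z}^d$. The critical inverse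 temperature $\beta_c>0$ is the infimum of those $\beta$ at which the spontaneous magnetization (the expectation of $\sigma_x$ in the plus state) is positive. For every $0\le\beta<\beta_c$ a constant $\mu>0$ as in the claim is known to exist (Aizenman–Barsky–Fernández). $|x-y|$ is the Euclidean distance. For $A=\{x_1,\dots,x_{2n}\}$, $D_s(A):=\min_{\pi\in S_{2n}}\sum_{j=1}^n|x_{\pi(2j-1)}-x_{\pi(2j)}|$, with $S_{2n}$ the symmetric group. *)

(* Defs.v *)
From HB Require Import structures.
From mathcomp Require Import all_boot all_order all_algebra all_fingroup.
From mathcomp Require Import finmap.
From mathcomp Require Import all_classical all_reals all_analysis.
From mathcomp.analysis.showcase Require Import summability.

Set Implicit Arguments.
Unset Strict Implicit.
Unset Printing Implicit Defensive.

Import Order.TTheory GRing.Theory Num.Theory.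
Import numFieldNormedType.Exports.

Local Open Scope classical_set_scope.
Local Open Scope ring_scope.

Notation site d := 'rV[int]_d.

Section Ising.
Variables (R : realType) (d : nat).
Implicit Types (L A : {fset site d}) (x y : site d) (s : site d -> R)
  (beta : R) (H f : (site d -> R) -> R).

Definition dist x y : R :=
  Num.sqrt (\sum_(i < d) (x 0 i - y 0 i)%:~R ^+ 2).

Definition coupling x y : R := if dist x y == 1 then 1 else 0.

(* Observables and Hamiltonians are functions of a spin field on the whole
   lattice, of which only the values at finitely many sites matter. *)

(* The comparison of ranks makes each unordered pair {x, y} with x != y
   be counted once. *)
Definition hamiltonian L s : R :=
  - (2^-1 * \sum_(x : L) \sum_(y : L | (enum_rank x < enum_rank y)%N)
              coupling (val x) (val y) * s (val x) * s (val y)).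

(* Pairs with one site in L and the other one frozen at spin +1; the inner
   sum has finite support. *)
Definition plus_hamiltonian L s : R :=
  hamiltonian L s
  - 2^-1 * \sum_(x : L) \sum_(y \in ~` [set` L]) coupling (val x) y * s (val x).

(* The value 1 outside L is a convention: it plays no role for observables
   that only depend on the spins in L. *)
Definition spins L (sigma : {ffun L -> bool}) x : R :=
  if insub x is Some u then (-1) ^+ sigma u else 1.

Definition tr L f : R :=
  (\sum_(sigma : {ffun L -> bool}) f (spins sigma)) / 2 ^+ #|` L|.

Definition gibbs L H beta f : R :=
  tr L (fun s => f s * expR (- beta * H s)) /
  tr L (fun s => expR (- beta * H s)).

(* [totally] is the filter of finite sets generated by the upper sets
   {L | L0 `<=` L}: the limits are along the finite subsets of the lattice
   directed by inclusion. *)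
Definition ising beta f : R :=
  lim ((fun L => gibbs L (hamiltonian L) beta f) @ totally).

Definition ising_plus beta f : R :=
  lim ((fun L => gibbs L (plus_hamiltonian L) beta f) @ totally).

(* The plus state is translation invariant, hence the choice of the origin. *)
Definition magnetization beta : R := ising_plus beta (fun s => s 0).

Definition beta_c : R :=
  inf [set beta : R | 0 <= beta /\ 0 < magnetization beta].

Definition spin_prod A s : R := \prod_(x <- A) s x.

End Ising.

Lemma even_ord_subproof n (j : 'I_n) : (j.*2 < n.*2)%N.
Proof. by rewrite ltn_double. Qed.

Lemma odd_ord_subproof n (j : 'I_n) : (j.*2.+1 < n.*2)%N.
Proof. by rewrite ltn_Sdouble. Qed.

Definition even_ord n (j : 'I_n) : 'I_n.*2 := Ordinal (even_ord_subproof j).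
Definition odd_ord n (j : 'I_n) : 'I_n.*2 := Ordinal (odd_ord_subproof j).

Section PairingDistance.
Variables (R : realType) (d : nat) (A : {fset site d}).

Let n := #|` A|./2.

Definition point (i : 'I_n.*2) : site d := nth 0 (enum_fset A) i.

Definition pairing_length (p : 'S_n.*2) : R :=
  \sum_(j < n) dist R (point (p (even_ord j))) (point (p (odd_ord j))).

(* Meaningful for sets A of even cardinality. *)
Definition Ds : R :=
  pairing_length [arg min_(p < (1%g : 'S_n.*2)) pairing_length p]%O.

End PairingDistance.

(* Main.v *)
(** For a finite volume, expand both factors of [Z_A Z_0] over pairs of
    subgraphs (high-temperature expansion): [F1] with odd-degree vertices [A]
    and [F2] with none. Fix [x] in [A]. In the symmetric difference of [F1] and
    [F2], whose odd vertices are those of [A], a walk leads from [x] to some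
    other [y] in [A]; exchanging its edges between [F1] and [F2] preserves the
    weight and turns the sources [(A, 0)] into [(A - x - y, xy)]. This gives the
    Gaussian-type inequality
      <s_A> <= sum_(y in A, y != x) <s_x s_y> <s_(A - x - y)>.
    Half of the decay of each pair is kept to build the factor
    [exp (- mu/2 D_s(A))], and the other half makes the sum over [y] in the
    lattice converge, so that induction on [n] bounds [<s_A>] by
    [C^n exp (- mu/2 D_s(A))], which is stronger than what is claimed as
    [d >= 1]. Finite-volume correlations increase with the volume, so that they
    converge and those of pairs inherit the assumed decay. *)

Require Import Defs.
From HB Require Import structures.
From mathcomp Require Import all_boot all_order all_algebra all_fingroup.
From mathcomp Require Import finmap.
From mathcomp Require Import all_classical all_reals all_analysis.
From mathcomp.analysis.showcase Require Import summability.
From mathcomp Require Import lra ring.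

Import Order.TTheory GRing.Theory Num.Theory.
Import numFieldNormedType.Exports.

Set Implicit Arguments.
Unset Strict Implicit.
Unset Printing Implicit Defensive.

Local Open Scope ring_scope.

(** * Switching edges between two subgraphs *)

Section OddDegree.
Context {V : finType}.
Implicit Types (F K S : {set V * V}) (e : V * V) (v x y : V).

(** The exclusive or gives a loop no endpoint, so that loops never change the parity of a degree. *)
Definition endpoint e v : bool := (v == e.1) (+) (v == e.2).

Definition odd_deg F v : bool := \big[addb/false]_(e in F) endpoint e v.

Definition symdiff F K : {set V * V} := [set e | (e \in F) (+) (e \in K)].

Lemma odd_deg_symdiff F K v :
  odd_deg (symdiff F K) v = odd_deg F v (+) odd_deg K v.
Proof.
rewrite /odd_deg big_mkcond (big_mkcond (fun e => e \in F)).
rewrite (big_mkcond (fun e => e \in K)) -big_split /=.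
apply: eq_bigr => e _; rewrite inE.
by case: (e \in F); case: (e \in K); case: endpoint.
Qed.

Lemma odd_degD1 F e v : e \in F ->
  odd_deg (F :\ e) v = odd_deg F v (+) endpoint e v.
Proof.
by move=> eF; rewrite /odd_deg [in RHS](big_setD1 e) //= addbC addKb.
Qed.

Lemma endpoint_sym x z v : endpoint (x, z) v = endpoint (z, x) v.
Proof. by rewrite /endpoint addbC. Qed.

(* Follow edges of [S] starting from [x], deleting each edge once it is used:
   the walk can only stop at another vertex of odd degree. *)
Lemma odd_deg_path S x : odd_deg S x ->
  exists K y, [/\ K \subset S, y != x, odd_deg S y &
                  forall v, odd_deg K v = endpoint (x, y) v].
Proof.
have [n leSn] := ubnP #|S|; elim: n => // n IHn in S x leSn *.
move=> oddSx.
have /existsP[e /andP[eS ex]] : [exists e, (e \in S) && endpoint e x].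
  apply: contraTT oddSx; rewrite negb_exists => /forallP noe.
  rewrite /odd_deg big1 // => e eS; apply/negbTE.
  by have := noe e; rewrite eS.
have [z zx ez] : exists2 z, z != x & forall v, endpoint e v = endpoint (x, z) v.
  case: e ex {eS} => u w; rewrite {1}/endpoint /=.
  have [<-|xu] := eqVneq x u.
    by move=> /= xw; exists w; rewrite // eq_sym.
  rewrite /= => /eqP <-; exists u; rewrite 1?eq_sym // => v.
  exact: endpoint_sym.
have ezz : endpoint (x, z) z by rewrite /endpoint /= eqxx (negbTE zx).
(* If [z] is odd, the edge [e] alone is the walk; otherwise deleting [e] makes [z] odd and the walk
   goes on from there. *)
have [Sz|Sz] := boolP (odd_deg S z).
  exists [set e], z; split=> //; first by rewrite finset.sub1set.
  by move=> v; rewrite /odd_deg big_set1 ez.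
have cardS : (#|S :\ e| < n)%N.
  by move: leSn; rewrite (cardsD1 e S) eS ltnS.
have oddz : odd_deg (S :\ e) z by rewrite odd_degD1 // ez ezz addbT.
have [K [y [KS yz Sy Kd]]] := IHn _ _ cardS oddz.
have yx : y != x.
  apply: contraTneq Sy => ->.
  by rewrite odd_degD1 // ez oddSx /endpoint /= eqxx eq_sym (negbTE zx).
have eK : e \notin K by apply/negP => /(fintype.subsetP KS); rewrite !inE eqxx.
exists (e |: K), y; split=> //.
- rewrite finset.subUset finset.sub1set eS (fintype.subset_trans KS) //.
  exact: finset.subD1set.
- move: Sy; rewrite odd_degD1 // ez /endpoint /=.
  by rewrite (negbTE yx) (negbTE yz) !addbF.
- move=> v; rewrite /odd_deg big_setU1 //= -[X in _ (+) X]/(odd_deg K v) Kd ez.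
  by rewrite /endpoint /=; do 3 case: (_ == _).
Qed.

(** The choice depends on [S] and [x] only. Hence [switch], which preserves the symmetric
    difference, finds the same route when applied again and undoes itself. *)
Definition route S x : {set V * V} * V :=
  odflt (finset.set0, x) [pick p : {set V * V} * V |
    [&& p.1 \subset S, p.2 != x, odd_deg S p.2 &
        [forall v, odd_deg p.1 v == endpoint (x, p.2) v]]].

Lemma routeP S x : odd_deg S x ->
  let: (K, y) := route S x in
  [/\ K \subset S, y != x, odd_deg S y &
      forall v, odd_deg K v = endpoint (x, y) v].
Proof.
move=> oddSx; rewrite /route; case: pickP => [[K y]|nop] /=.
  by case/and4P => KS yx Sy /forallP Kd; split => // v; apply/eqP.
have [K [y [KS yx Sy Kd]]] := odd_deg_path oddSx.
have := nop (K, y); rewrite /= KS yx Sy /=.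
by move/negbT/negP; case; apply/forallP => v; rewrite Kd.
Qed.

Definition switch x (p : {set V * V} * {set V * V}) :=
  let K := (route (symdiff p.1 p.2) x).1 in (symdiff p.1 K, symdiff p.2 K).

Lemma symdiff_switch x p :
  symdiff (switch x p).1 (switch x p).2 = symdiff p.1 p.2.
Proof.
by apply/finset.setP => e; rewrite !inE; do 3 case: (_ \in _).
Qed.

Lemma switchK x : involutive (switch x).
Proof.
move=> p; rewrite {1}/switch symdiff_switch.
rewrite [RHS]surjective_pairing; congr pair; apply/finset.setP => e;
  by rewrite !inE; do 2 case: (_ \in _).
Qed.

End OddDegree.

(** * The switching inequality for weighted subgraphs *)

Section Switching.
Context {R : realType} {V : finType}.
Implicit Types (F K S : {set V * V}) (e : V * V) (v x y : V).
Implicit Types (c d : V * V -> R) (b : V -> bool).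

Definition graph_weight c d F : R := \prod_e (if e \in F then d e else c e).

Definition graph_sum c d b : R :=
  \sum_(F | [forall v, odd_deg F v == b v]) graph_weight c d F.

Lemma graph_weight_ge0 c d F : (forall e, 0 <= c e) -> (forall e, 0 <= d e) ->
  0 <= graph_weight c d F.
Proof. by move=> c0 d0; apply: prodr_ge0 => e _; case: ifP. Qed.

(** Each edge of the route lies in exactly one of the two subgraphs, so moving it to the other one
    only permutes the factors [c e] and [d e]. *)
Lemma graph_weight_switch c d x p : odd_deg (symdiff p.1 p.2) x ->
  graph_weight c d (switch x p).1 * graph_weight c d (switch x p).2 =
  graph_weight c d p.1 * graph_weight c d p.2.
Proof.
move=> /routeP; rewrite /switch; case: route => K y [/fintype.subsetP KS _ _ _].
rewrite -!big_split; apply: eq_bigr => e _ /=; have := KS e; rewrite !inE.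
by case: (e \in p.1); case: (e \in p.2); case: (e \in K) => //=;
  try (by move=> /(_ isT)); rewrite mulrC.
Qed.

Lemma graph_sum_mul c d b b' : graph_sum c d b * graph_sum c d b' =
  \sum_(p : {set V * V} * {set V * V} |
      [forall v, odd_deg p.1 v == b v] && [forall v, odd_deg p.2 v == b' v])
    graph_weight c d p.1 * graph_weight c d p.2.
Proof. by rewrite /graph_sum big_distrlr /= pair_big. Qed.

(** Pairs are grouped by the endpoint [y] of their route. The involution [switch x] maps each group
    injectively, at equal weight, into the pairs whose sources are [b] changed at [x] and [y], and
    [{x, y}]. *)
Lemma switching c d b x : (forall e, 0 <= c e) -> (forall e, 0 <= d e) -> b x ->
  graph_sum c d b * graph_sum c d xpred0 <=
  \sum_(y | b y && (y != x))
     graph_sum c d (endpoint (x, y)) *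
     graph_sum c d (fun v => b v (+) endpoint (x, y) v).
Proof.
move=> c0 d0 bx; rewrite graph_sum_mul.
have odd_b p v : [forall v, odd_deg p.1 v == b v] ->
    [forall v, odd_deg p.2 v == false] -> odd_deg (symdiff p.1 p.2) v = b v.
  move=> /forallP /(_ v) /eqP p1 /forallP /(_ v) /eqP p2.
  by rewrite odd_deg_symdiff p1 p2 addbF.
rewrite (partition_big (fun p => (route (symdiff p.1 p.2) x).2)
          (fun y => b y && (y != x))) /=; last first.
  move=> p /andP[p1 p2]; have := odd_b p x p1 p2; rewrite bx => /routeP.
  by case: route => K y [_ yx + _] /=; rewrite (odd_b p y p1 p2) yx => ->.
apply: ler_sum => y _; rewrite mulrC graph_sum_mul.
(* After this reindexing both sides sum the same weights over nested sets of pairs; the extra terms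
   on the right are nonnegative. *)
rewrite [leRHS](reindex_inj (inv_inj (switchK x))) /=.
rewrite big_mkcond [leRHS]big_mkcond /=; apply: ler_sum => p _.
case: ifP => [|_]; last first.
  by case: ifP => // _; rewrite mulr_ge0 ?graph_weight_ge0.
case/andP => /andP[p1 p2] py; have := odd_b p x p1 p2; rewrite bx => odd_x.
rewrite graph_weight_switch //; case: ifP => // /negP[].
move: odd_x py => /routeP; rewrite /switch.
case: route => K z [_ _ _ Kd] /= /eqP <-.
move/forallP in p1; move/forallP in p2.
by apply/andP; split; apply/forallP => v; rewrite odd_deg_symdiff Kd;
  rewrite ?(eqP (p1 v)) ?(eqP (p2 v)).
Qed.

End Switching.

(** * Correlations of a ferromagnetic Ising model on a finite graph *)

Section IsingModel.
Context {R : realType} {V : finType}.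
Implicit Types (s w : {ffun V -> bool}) (b : V -> bool) (a c d : V * V -> R).
Implicit Types (F : {set V * V}) (e : V * V) (v x y : V) (B : {set V}).

(** With the spin at [v] written [(-1) ^+ s v], these are the characters of the group of
    configurations under addition modulo 2. *)
Definition chi s b : R := \prod_v (-1) ^+ (s v && b v).

Lemma eq_chi s b b' : b =1 b' -> chi s b = chi s b'.
Proof. by move=> bb; apply: eq_bigr => v _; rewrite bb. Qed.

Lemma chi_addb s b b' : chi s (fun v => b v (+) b' v) = chi s b * chi s b'.
Proof.
by rewrite /chi -big_split; apply: eq_bigr => v _; rewrite andb_addr signr_addb.
Qed.

Lemma chi_mul s w b : chi [ffun v => s v (+) w v] b = chi s b * chi w b.
Proof.
rewrite /chi -big_split; apply: eq_bigr => v _.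
by rewrite ffunE andb_addl signr_addb.
Qed.

Lemma chi0 s : chi s xpred0 = 1.
Proof. by rewrite /chi big1 // => v _; rewrite andbF. Qed.

Lemma chi1 s v : chi s (pred1 v) = (-1) ^+ s v.
Proof.
rewrite /chi (bigD1 v) //= eqxx andbT big1 ?mulr1 // => u /negbTE ->.
by rewrite andbF.
Qed.

Lemma chi_endpoint s x y : chi s (endpoint (x, y)) = (-1) ^+ s x * (-1) ^+ s y.
Proof. by rewrite -!chi1 -chi_addb. Qed.

Lemma chi_mem s B : chi s (mem B) = \prod_(v in B) (-1) ^+ s v.
Proof.
rewrite /chi [RHS]big_mkcond; apply: eq_bigr => v _ /=.
by case: ifP; rewrite ?andbT ?andbF.
Qed.

Lemma chi_sign s b : exists z : bool, chi s b = (-1) ^+ z.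
Proof.
rewrite /chi; elim/big_ind: _ => [|_ _ [y ->] [z ->]|v _]; last by eexists.
- by exists false.
- by exists (y (+) z); rewrite signr_addb.
Qed.

Lemma chi_odd_deg s F : chi s (odd_deg F) = \prod_(e in F) chi s (endpoint e).
Proof.
rewrite /chi exchange_big; apply: eq_bigr => v _ /=; rewrite /odd_deg.
elim/big_rec2: _ => [|e z z' _ <-]; first by rewrite andbF.
by rewrite andb_addr signr_addb.
Qed.

(** Orthogonality of characters: the sum factorises over the vertices, and a vertex of [b]
    contributes [1 - 1]. *)
Lemma sum_chi b :
  \sum_s chi s b = if [forall v, ~~ b v] then 2 ^+ #|V| else 0.
Proof.
rewrite -(bigA_distr_bigA (fun v z => (-1) ^+ (z && b v))) /=.
under eq_bigr do rewrite big_bool /= expr0.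
case: forallP => [b0|].
  rewrite (eq_bigr (fun=> 2)) ?prodr_const // => v _.
  by rewrite (negbTE (b0 v)) expr0.
move/forallP; rewrite negb_forall => /existsP[v bv].
by rewrite (bigD1 v) //= (negbNE bv) expr1 addNr mul0r.
Qed.

(** Expand the product over the set [F] of edges that contribute their [d e] term: the sum over [s]
    only keeps the [F] whose odd vertices are those of [b]. *)
Lemma high_temperature c d b :
  \sum_s chi s b * \prod_e (c e + d e * chi s (endpoint e)) =
  2 ^+ #|V| * graph_sum c d b.
Proof.
transitivity (\sum_(F : {set V * V}) graph_weight c d F *
                \sum_s chi s (fun v => b v (+) odd_deg F v)).
  under [RHS]eq_bigr do rewrite big_distrr /=.
  rewrite exchange_big; apply: eq_bigr => s _ /=.
  under eq_bigr do rewrite addrC.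
  rewrite bigA_distr big_distrr /=; apply: eq_bigr => F _.
  rewrite chi_addb mulrCA; congr (_ * _).
  rewrite chi_odd_deg [X in _ = _ * X]big_mkcond -big_split /=.
  by apply: eq_bigr => e _; case: ifP; rewrite ?mulr1.
rewrite /graph_sum big_distrr [RHS]big_mkcond /=; apply: eq_bigr => F _.
rewrite sum_chi (@eq_forallb _ _ (fun v => odd_deg F v == b v)).
  by case: ifP; rewrite ?mulr0 // mulrC.
by move=> v; case: (b v); case: odd_deg.
Qed.

Definition boltzmann a s : R := \prod_e expR (a e * chi s (endpoint e)).

Definition moment a b : R := \sum_s chi s b * boltzmann a s.

Definition corr a b : R := moment a b / moment a xpred0.

Lemma boltzmann_gt0 a s : 0 < boltzmann a s.
Proof. by apply: prodr_gt0 => e _; apply: expR_gt0. Qed.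

Lemma boltzmannE a s : boltzmann a s = expR (\sum_e a e * chi s (endpoint e)).
Proof. by rewrite expR_sum. Qed.

Lemma eq_moment a b b' : b =1 b' -> moment a b = moment a b'.
Proof. by move=> bb; apply: eq_bigr => s _; rewrite (eq_chi _ bb). Qed.

Lemma eq_corr a b b' : b =1 b' -> corr a b = corr a b'.
Proof. by move=> bb; rewrite /corr (eq_moment _ bb). Qed.

Lemma moment0E a : moment a xpred0 = \sum_s boltzmann a s.
Proof. by apply: eq_bigr => s _; rewrite chi0 mul1r. Qed.

Lemma moment0_gt0 a : 0 < moment a xpred0.
Proof.
rewrite moment0E (bigD1 [ffun=> false]) //= ltr_pwDl ?boltzmann_gt0 //.
by apply: sumr_ge0 => s _; rewrite ltW ?boltzmann_gt0.
Qed.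

(** [expR_even] and [expR_odd] are the hyperbolic cosine and sine. *)
Definition expR_even (u : R) := (expR u + expR (- u)) / 2.
Definition expR_odd (u : R) := (expR u - expR (- u)) / 2.

Lemma expR_even_ge0 u : 0 <= expR_even u.
Proof. by rewrite divr_ge0 ?addr_ge0 ?expR_ge0. Qed.

Lemma expR_odd_ge0 u : 0 <= u -> 0 <= expR_odd u.
Proof.
by move=> u0; rewrite divr_ge0 // subr_ge0 ler_expR (le_trans _ u0) ?oppr_le0.
Qed.

(** For a sign [z], [exp (u z) = cosh u + z sinh u]. *)
Lemma momentE a b : moment a b =
  2 ^+ #|V| * graph_sum (expR_even \o a) (expR_odd \o a) b.
Proof.
rewrite -high_temperature; apply: eq_bigr => s _; congr (_ * _).
apply: eq_bigr => e _ /=; have [z ->] := chi_sign s (endpoint e).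
by rewrite /expR_even /expR_odd; case: z => /=;
  rewrite ?expr0 ?expr1 ?mulrN1 ?mulr1; field.
Qed.

(** Griffiths' first inequality: all weights of the expansion are nonnegative. *)
Lemma moment_ge0 a b : (forall e, 0 <= a e) -> 0 <= moment a b.
Proof.
move=> a0; rewrite momentE mulr_ge0 ?exprn_ge0 //; apply: sumr_ge0 => F _.
apply: graph_weight_ge0 => e /=; first exact: expR_even_ge0.
exact: expR_odd_ge0.
Qed.

Lemma corr_ge0 a b : (forall e, 0 <= a e) -> 0 <= corr a b.
Proof. by move=> a0; rewrite divr_ge0 ?moment_ge0. Qed.

Lemma corr_le1 a b : corr a b <= 1.
Proof.
rewrite ler_pdivrMr ?moment0_gt0 // mul1r moment0E; apply: ler_sum => s _.
rewrite ler_piMl //; first exact: ltW (boltzmann_gt0 a s).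
have [z ->] := chi_sign s b.
by case: z => /=; rewrite ?expr0 ?expr1 //; lra.
Qed.

Lemma gaussian_ineq a b x : (forall e, 0 <= a e) -> b x ->
  corr a b <= \sum_(y | b y && (y != x))
    corr a (endpoint (x, y)) * corr a (fun v => b v (+) endpoint (x, y) v).
Proof.
move=> a0 bx; have Z0 := moment0_gt0 a.
have Z00 : 0 < moment a xpred0 * moment a xpred0 by apply: mulr_gt0.
suff : moment a b * moment a xpred0 <= \sum_(y | b y && (y != x))
    moment a (endpoint (x, y)) * moment a (fun v => b v (+) endpoint (x, y) v).
  move=> le_b; rewrite -(ler_pM2r Z00) [leRHS]mulr_suml mulrA divfK ?gt_eqF //.
  apply: le_trans le_b _; apply: ler_sum => y _.
  by rewrite mulrACA !divfK ?gt_eqF.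
rewrite !momentE mulrACA.
under [leRHS]eq_bigr do rewrite !momentE mulrACA.
rewrite -big_distrr /= ler_pM2l ?mulr_gt0 ?exprn_gt0 //.
apply: switching => // e; first exact: expR_even_ge0.
exact: expR_odd_ge0.
Qed.

(* Ginibre's duplication: in terms of two independent copies [s] and
   [t = s * w], the difference of both sides is a sum over [w] of moments with
   couplings [a' e + a e * chi w (endpoint e)], which are nonnegative. *)
Lemma corr_le a a' b : (forall e, 0 <= a e <= a' e) -> corr a b <= corr a' b.
Proof.
move=> aa'; rewrite /corr ler_pdivrMr ?moment0_gt0 // mulrAC.
rewrite ler_pdivlMr ?moment0_gt0 // -subr_ge0.
pose sw w s : {ffun V -> bool} := [ffun v => s v (+) w v].
have swK w : involutive (sw w).
  by move=> s; apply/ffunP => v; rewrite !ffunE addbK.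
suff -> : moment a' b * moment a xpred0 - moment a b * moment a' xpred0 =
    \sum_w (1 - chi w b) * moment (fun e => a' e + a e * chi w (endpoint e)) b.
  apply: sumr_ge0 => w _; apply: mulr_ge0.
    have [[] ->] := chi_sign w b; last by rewrite subrr.
    by rewrite /= expr1 opprK addr_ge0.
  apply: moment_ge0 => e; have /andP[a0 ae] := aa' e.
  have [[] ->] := chi_sign w (endpoint e).
    by rewrite /= expr1 mulrN1 subr_ge0.
  by rewrite /= expr0 mulr1 addr_ge0 // (le_trans a0).
transitivity (\sum_s \sum_t (chi s b - chi t b) *
                (boltzmann a' s * boltzmann a t)).
  rewrite [X in _ - X]mulrC !moment0E /moment !big_distrlr -sumrB /=.
  apply: eq_bigr => s _; rewrite -sumrB; apply: eq_bigr => t _.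
  by ring.
under [RHS]eq_bigr do rewrite big_distrr /=.
rewrite [RHS]exchange_big; apply: eq_bigr => s _ /=.
rewrite (reindex_inj (inv_inj (swK s))); apply: eq_bigr => w _.
have -> : sw s w = sw w s by apply/ffunP => v; rewrite !ffunE addbC.
rewrite chi_mul [RHS]mulrA; congr (_ * _); first by ring.
rewrite /boltzmann -big_split; apply: eq_bigr => e _ /=.
by rewrite chi_mul -expRD mulrDl mulrAC -mulrA.
Qed.

End IsingModel.

(** * Dependence on the volume *)

Section Embedding.
Context {R : realType}.

Lemma prod_injective (T U : finType) (g : T -> U) (G : U -> R) : injective g ->
  (forall u, u \notin codom g -> G u = 1) -> \prod_u G u = \prod_t G (g t).
Proof.
move=> g_inj G1; rewrite (bigID (mem (codom g))) /= [X in _ * X]big1 // mulr1.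
have <- : \prod_(u <- codom g) G u = \prod_t G (g t) by rewrite big_image.
rewrite -big_filter.
apply: perm_big; apply: uniq_perm.
- by rewrite filter_uniq // index_enum_uniq.
- by rewrite map_inj_uniq // enum_uniq.
- by move=> u; rewrite mem_filter mem_index_enum andbT.
Qed.

Context {V W : finType} (h : V -> W) (h_inj : injective h).

Definition edge_map (e : V * V) : W * W := (h e.1, h e.2).

Lemma edge_map_inj : injective edge_map.
Proof. by move=> [x y] [x' y'] [/h_inj -> /h_inj ->]. Qed.

Definition restrict (t : {ffun W -> bool}) : {ffun V -> bool} :=
  [ffun v => t (h v)].

(* All fibres of [restrict] have the same number of elements, since [restrict]
   is a group morphism for the pointwise addition of booleans. *)
Lemma sum_restrict (g : {ffun V -> bool} -> R) :
  \sum_t g (restrict t) =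
  #|[pred t | restrict t == [ffun=> false]]|%:R * \sum_s g s.
Proof.
rewrite (partition_big restrict predT) //= mulr_sumr; apply: eq_bigr => s _.
rewrite (eq_bigr (fun=> g s)) => [|t /eqP -> //].
rewrite sumr_const mulr_natl; congr (_ *+ _).
(* Adding an extension [ext] of [s] maps the fibre over [s] bijectively onto the fibre over zero. *)
have [ext extE] : exists ext : {ffun W -> bool}, forall v, ext (h v) = s v.
  exists [ffun w => if [pick v | h v == w] is Some v then s v else false] => v.
  by rewrite ffunE; case: pickP => [u /eqP /h_inj -> //|/(_ v)]; rewrite eqxx.
pose tr (t : {ffun W -> bool}) : {ffun W -> bool} := [ffun w => t w (+) ext w].
have trK : involutive tr by move=> t; apply/ffunP => w; rewrite !ffunE addbK.
have restrict_tr t : (restrict t == s) = (restrict (tr t) == [ffun=> false]).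
  apply/eqP/eqP => eqt; apply/ffunP => v;
    have := congr1 (fun f : {ffun V -> bool} => f v) eqt;
    rewrite !ffunE extE.
    by move=> ->; rewrite addbb.
  by case: (t _); case: (s v).
rewrite -(fintype.card_image (inv_inj trK)); apply: eq_card => t.
rewrite -[t in LHS]trK (fintype.mem_image (inv_inj trK)).
by rewrite -[LHS]/(restrict (tr t) == s) restrict_tr trK.
Qed.

Variables (b : V -> bool) (b' : W -> bool).
Hypotheses (b'h : forall v, b' (h v) = b v)
  (b'0 : forall w, w \notin codom h -> b' w = false).

Lemma chi_restrict t : chi t b' = chi (restrict t) b :> R.
Proof.
rewrite /chi (prod_injective h_inj) => [|w /b'0 ->]; last by rewrite andbF.
by apply: eq_bigr => v _; rewrite ffunE b'h.
Qed.

End Embedding.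

Section Volume.
Context {R : realType} {V W : finType} (h : V -> W) (h_inj : injective h).
Implicit Types (a : W * W -> R) (b : V -> bool).

(** Cutting the couplings outside the image of [h] represents the smaller model on the vertices of
    the larger one, where [corr_le] applies. *)
Definition cut_coupling a e : R := if e \in codom (edge_map h) then a e else 0.

Lemma boltzmann_restrict a t :
  boltzmann (cut_coupling a) t = boltzmann (a \o edge_map h) (restrict h t).
Proof.
rewrite /boltzmann (prod_injective (edge_map_inj h_inj)) => [|e /negbTE ne].
  apply: eq_bigr => -[x y] _; rewrite /cut_coupling codom_f /= !chi_endpoint.
  by rewrite !ffunE.
by rewrite /cut_coupling ne mul0r expR0.
Qed.

(** The spins outside the image are free: they contribute a factor independent of [b], which cancels
    in [corr]. *)
Lemma moment_cut a b (b' : W -> bool) : (forall v, b' (h v) = b v) ->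
    (forall w, w \notin codom h -> b' w = false) ->
  moment (cut_coupling a) b' =
  #|[pred t | restrict h t == [ffun=> false]]|%:R * moment (a \o edge_map h) b.
Proof.
move=> b'h b'0; rewrite -sum_restrict //; apply: eq_bigr => t _.
by rewrite (chi_restrict h_inj b'h b'0) boltzmann_restrict.
Qed.

Lemma corr_embed_le a b (b' : W -> bool) : (forall e, 0 <= a e) ->
    (forall v, b' (h v) = b v) ->
    (forall w, w \notin codom h -> b' w = false) ->
  corr (a \o edge_map h) b <= corr a b'.
Proof.
move=> a0 b'h b'0.
have -> : corr (a \o edge_map h) b = corr (cut_coupling a) b'.
  rewrite /corr (moment_cut _ b'h b'0) (@moment_cut _ xpred0 xpred0) //.
  rewrite -mulf_div divff ?mul1r // pnatr_eq0 -lt0n.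
  apply/card_gt0P; exists [ffun=> false]; rewrite inE.
  by apply/eqP/ffunP => v; rewrite !ffunE.
by apply: corr_le => e; rewrite /cut_coupling; case: ifP; rewrite ?lexx a0.
Qed.

End Volume.

(** * Summability of the decay over the lattice *)

Section LatticeSum.
Context {R : realType}.

Lemma ler_sum_uniq_subset (T : eqType) (s t : seq T) (G : T -> R) :
  uniq s -> uniq t -> {subset s <= t} -> (forall x, 0 <= G x) ->
  \sum_(x <- s) G x <= \sum_(x <- t) G x.
Proof.
move=> us ut st G0.
rewrite (perm_big [seq x <- t | x \in s]) /=; last first.
  apply: uniq_perm; rewrite ?filter_uniq // => x; rewrite mem_filter.
  by case: (boolP (x \in s)) => // /st ->.
by rewrite big_filter big_mkcond; apply: ler_sum => x _; case: ifP.
Qed.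

Lemma geometric_sum_le (q : R) N : 0 <= q < 1 ->
  \sum_(i < N) q ^+ i <= (1 - q)^-1.
Proof.
case/andP => q0 q1; have q1' : 0 < 1 - q by rewrite subr_gt0.
rewrite -(ler_pM2l q1') divff ?gt_eqF // -opprB mulNr -subrX1 opprB.
by rewrite lerBlDr lerDl exprn_ge0.
Qed.

(** One geometric series bounds the nonnegative integers and another one the negative integers. *)
Lemma sum_expR_int_le (k : R) (r : seq int) : 0 < k -> uniq r ->
  \sum_(m <- r) expR (- k * `|m%:~R|) <= 2 / (1 - expR (- k)).
Proof.
move=> k0 ur; set q := expR (- k).
have q01 : 0 <= q < 1 by rewrite expR_ge0 expR_lt1 oppr_lt0.
have [N rN] : exists N, forall m, m \in r -> (absz m < N)%N.
  exists (\max_(m <- r) absz m).+1 => m mr; rewrite ltnS.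
  by rewrite (big_rem m) //= leq_maxl.
pose t := [seq Posz n | n <- iota 0 N] ++ [seq Negz n | n <- iota 0 N].
have ut : uniq t.
  have Posz_inj : injective Posz by move=> ? ? [].
  have Negz_inj : injective Negz by move=> ? ? [].
  rewrite cat_uniq (map_inj_uniq Posz_inj) (map_inj_uniq Negz_inj) iota_uniq.
  by rewrite andbT; apply/hasPn => _ /mapP[n _ ->] /=; apply/mapP => -[].
have rt : {subset r <= t}.
  move=> m /rN; rewrite mem_cat; case: m => n /= nN; apply/orP.
    by left; apply: map_f; rewrite mem_iota.
  by right; apply: map_f; rewrite mem_iota /= add0n ltnW.
apply: le_trans (ler_sum_uniq_subset ur ut rt _) _ => [m|].
  exact: expR_ge0.
rewrite big_cat !big_map /= mulrDl mul1r.
have E n : expR (- k * n%:R) = q ^+ n by rewrite mulrC expRM_natl.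
apply: lerD; (apply: le_trans _ (geometric_sum_le N q01);
  rewrite -(big_mkord xpredT (fun i => q ^+ i))).
  rewrite /index_iota subn0; apply: ler_sum => n _.
  by rewrite -pmulrn normr_nat E.
rewrite /index_iota subn0; apply: ler_sum => n _.
(* [Negz n] is [-(n + 1)]; its extra factor [q <= 1] is dropped. *)
rewrite NegzE mulrNz normrN -pmulrn normr_nat E exprS.
by case/andP: q01 => q0 q1; rewrite ler_piMl ?exprn_ge0 // ltW.
Qed.

Lemma coord_le_dist d (x y : site d) i :
  `|(x 0 i - y 0 i)%:~R| <= dist R x y.
Proof.
rewrite -sqrtr_sqr ler_sqrt; last by apply: sumr_ge0 => j _; exact: sqr_ge0.
by rewrite (bigD1 i) //= lerDl; apply: sumr_ge0 => j _; exact: sqr_ge0.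
Qed.

Lemma dist_ge0 d (x y : site d) : 0 <= dist R x y.
Proof. exact: sqrtr_ge0. Qed.

(** The distance dominates every coordinate difference, hence their mean, so that the exponential is
    at most a product over the coordinates with rate [c / d]. *)
Lemma sum_expR_dist_le d (c : R) (x : site d) (s : seq (site d)) :
  (0 < d)%N -> 0 < c -> uniq s ->
  \sum_(y <- s) expR (- c * dist R x y) <= (2 / (1 - expR (- (c / d%:R)))) ^+ d.
Proof.
move=> d0 c0 us; set k := c / d%:R.
have d0R : 0 < d%:R :> R by rewrite ltr0n.
have k0 : 0 < k by rewrite divr_gt0.
pose g (i : 'I_d) (m : int) := expR (- k * `|(x 0 i - m)%:~R|) : R.
apply: (@le_trans _ _ (\sum_(y <- s) \prod_i g i (y 0 i))).
  apply: ler_sum => y _; rewrite -expR_sum ler_expR -mulr_sumr !mulNr lerN2.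
  rewrite /k -mulrA ler_pM2l // ler_pdivrMl //.
  rewrite mulr_natl -[leRHS](_ : \sum_(i < d) dist R x y = _).
    by apply: ler_sum => i _; exact: coord_le_dist.
  by rewrite sumr_const card_ord.
(* Enlarging [s] to the box of all points with coordinates in [M] turns the sum of products into a
   product of sums. *)
pose M := undup (flatten [seq [seq y 0 i | i <- enum 'I_d] | y : site d <- s]).
pose z (f : {ffun 'I_d -> seq_sub M}) : site d := \row_i val (f i).
have z_inj : injective z.
  move=> f f' /rowP ff'; apply/ffunP => i; apply: val_inj.
  by have := ff' i; rewrite !mxE.
have sz : {subset s <= codom z}.
  move=> y ys; have yM i : y 0 i \in M.
    rewrite mem_undup; apply/flattenP; exists [seq y 0 i | i <- enum 'I_d].
      exact: map_f.
    by apply: map_f; rewrite mem_enum.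
  apply/codomP; exists [ffun i => SeqSub (yM i)].
  by apply/rowP => i; rewrite !mxE ffunE.
apply: le_trans (ler_sum_uniq_subset us _ sz _) _.
- by rewrite map_inj_uniq ?enum_uniq.
- by move=> y; apply: prodr_ge0 => i _; exact: expR_ge0.
rewrite big_image /=.
under eq_bigr do under eq_bigr do rewrite mxE.
rewrite -(bigA_distr_bigA (fun i (m : seq_sub M) => g i (val m))) /=.
rewrite -[leRHS](_ : \prod_(i < d) (2 / (1 - expR (- k))) = _); last first.
  by rewrite prodr_const card_ord.
apply: ler_prod => i _.
rewrite sumr_ge0 => [|m _]; last exact: expR_ge0.
pose r := [seq x 0 i - val m | m <- enum {: seq_sub M}].
have ur : uniq r.
  rewrite map_inj_uniq ?enum_uniq // => m m' /addrI /oppr_inj; exact: val_inj.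
by have := sum_expR_int_le k0 ur; rewrite big_map big_enum.
Qed.

End LatticeSum.

(** * Decay along pairings *)

Section Pairings.
Context {R : realType} {V : finType}.
Implicit Types (x y : V) (B : {set V}) (pl : seq (V * V)).

(** Half of the rate [2 * c] pays for [D], the other half is summed over the partner [y] of a fixed
    [x]. Taking for [D] any lower bound on the pairing lengths lets the induction pass to
    [D - dst x y]. *)
Lemma corr_decay (a : V * V -> R) (dst : V -> V -> R) (c K : R) :
    (forall e, 0 <= a e) -> 0 < c -> 0 <= K ->
    (forall x y, x != y ->
       corr a (endpoint (x, y)) <= expR (- (2 * c) * dst x y)) ->
    (forall x, \sum_y expR (- c * dst x y) <= K) ->
  forall n B (D : R), #|B| = (2 * n)%N ->
    (forall pl, perm_eq (flatten [seq [:: p.1; p.2] | p <- pl]) (enum B) ->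
       D <= \sum_(p <- pl) dst p.1 p.2) ->
  corr a (mem B) <= K ^+ n * expR (- c * D).
Proof.
move=> a0 c0 K0 a_decay sumK; elim=> [|n IHn] B D cardB leD.
  apply: le_trans (corr_le1 _ _) _; rewrite expr0 mul1r -expR0 ler_expR.
  rewrite mulNr oppr_ge0 pmulr_rle0 //.
  (* The empty set has the empty pairing, whence [D <= 0]. *)
  have := leD [::]; rewrite big_nil; apply => /=.
  by move/eqP: cardB; rewrite muln0 cards_eq0 => /eqP ->; rewrite enum_set0.
have /card_gt0P[x xB] : (0 < #|B|)%N by rewrite cardB mulnS.
apply: le_trans (gaussian_ineq a0 xB) _.
apply: (@le_trans _ _ (\sum_(y | (y \in B) && (y != x))
    (K ^+ n * expR (- c * D)) * expR (- c * dst x y))); last first.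
  rewrite -mulr_sumr exprS -[in leRHS]mulrA [leRHS]mulrC.
  rewrite ler_wpM2l ?mulr_ge0 ?exprn_ge0 ?expR_ge0 //.
  apply: le_trans (sumK x); rewrite [leLHS]big_mkcond.
  by apply: ler_sum => y _; case: ifP; rewrite ?expR_ge0.
apply: ler_sum => y /andP[By yx]; have yB : y \in B by [].
pose B' := B :\ x :\ y.
have BE : (fun v => (v \in B) (+) endpoint (x, y) v) =1 mem B'.
  move=> v; rewrite /endpoint -[RHS]/(v \in B :\ x :\ y) /= !inE.
  case: eqVneq => [->|_]; first by rewrite xB eq_sym (negbTE yx).
  by case: eqVneq => [->|_]; rewrite ?yB //= addbF.
rewrite (eq_corr _ BE).
have cardB' : #|B'| = (2 * n)%N.
  move: cardB; rewrite (cardsD1 x) xB (cardsD1 y) !inE yx yB mulnS.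
  by rewrite addnA; exact: (@addnI 2).
have leD' pl : perm_eq (flatten [seq [:: p.1; p.2] | p <- pl]) (enum B') ->
    D - dst x y <= \sum_(p <- pl) dst p.1 p.2.
  (* Prepending [(x, y)] turns a pairing of [B'] into one of [B]. *)
  move=> plB'; rewrite lerBlDl.
  have := leD ((x, y) :: pl); rewrite big_cons; apply => /=.
  apply: (@perm_trans _ (x :: y :: enum B')); first by rewrite !perm_cons.
  apply: uniq_perm; rewrite ?enum_uniq //=.
    rewrite enum_uniq inE !mem_enum !inE !eqxx /= andbF andbT orbF.
    by rewrite eq_sym yx.
  move=> v; rewrite !inE !mem_enum !inE.
  by case: eqVneq => [->|_] //=; case: eqVneq => [->|_].
apply: le_trans (ler_pM _ _ (a_decay _ _ _) (IHn _ _ cardB' leD')) _.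
- exact: corr_ge0.
- exact: corr_ge0.
- by rewrite eq_sym.
rewrite mulrCA -!mulrA ler_wpM2l ?exprn_ge0 // -!expRD ler_expR.
by rewrite le_eqVlt; apply/orP; left; apply/eqP; ring.
Qed.

End Pairings.

Lemma flatten_pairs_nth (T : Type) (x0 : T) (pl : seq (T * T)) j :
  (nth x0 (flatten [seq [:: p.1; p.2] | p <- pl]) j.*2 =
     (nth (x0, x0) pl j).1) /\
  (nth x0 (flatten [seq [:: p.1; p.2] | p <- pl]) j.*2.+1 =
     (nth (x0, x0) pl j).2).
Proof. by elim: pl j => [|p pl IHpl] [|j] //=; rewrite ?nth_nil. Qed.

Lemma size_flatten_pairs (T : Type) (pl : seq (T * T)) :
  size (flatten [seq [:: p.1; p.2] | p <- pl]) = (size pl).*2.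
Proof. by elim: pl => //= p pl ->. Qed.

Section PairingDistance.
Context {R : realType} {d : nat}.

(** Flattening the pairs lists [A] in a permuted order, and that permutation competes in the minimum
    defining [Ds]. *)
Lemma Ds_le (A : {fset site d}) (pl : seq (site d * site d)) :
  perm_eq (flatten [seq [:: p.1; p.2] | p <- pl]) (enum_fset A) ->
  Ds R A <= \sum_(p <- pl) dist R p.1 p.2.
Proof.
set s := flatten _ => sA; have := perm_size sA; rewrite size_flatten_pairs.
move=> sizeA; have halfA : (#|` A|./2 = size pl)%N by rewrite -sizeA doubleK.
have sizeAE : size (enum_fset A) == (#|` A|./2).*2 by rewrite halfA sizeA.
have [p sE] := tuple_permP (t := Tuple sizeAE) sA.
have /le_trans -> // : Ds R A <= pairing_length R p.
  by rewrite /Ds; case: Order.TotalTheory.arg_minP => // q _ /(_ p); apply.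
rewrite (big_nth (0, 0)) big_mkord /pairing_length -halfA.
rewrite le_eqVlt; apply/orP; left; apply/eqP; apply: eq_bigr => j _.
have pointE k : Defs.point (p k) = nth 0 s k.
  rewrite sE -tnth_nth tnth_mktuple (tnth_nth 0) /=; congr nth.
by have [<- <-] := flatten_pairs_nth 0 pl j; rewrite !pointE.
Qed.

Lemma Ds_ge0 (A : {fset site d}) : 0 <= Ds R A.
Proof. by apply: sumr_ge0 => j _; exact: dist_ge0. Qed.

End PairingDistance.

(** * Ising correlations on the lattice *)

Section FiniteVolume.
Context {R : realType} {d : nat}.
Implicit Types (L A : {fset site d}) (beta : R).

(* The factor 4 collects the 1/2 of the Hamiltonian and the fact that [L * L]
   contains each unordered pair twice. *)
Definition volume_coupling L beta (e : L * L) : R :=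
  beta / 4 * coupling R (val e.1) (val e.2).

Lemma volume_coupling_ge0 L beta (e : L * L) :
  0 <= beta -> 0 <= volume_coupling beta e.
Proof.
move=> beta0; rewrite /volume_coupling mulr_ge0 ?divr_ge0 //.
by rewrite /coupling; case: ifP.
Qed.

Lemma sum_ordered_pairs (T : finType) (g : T -> T -> R) :
    (forall x y, g x y = g y x) -> (forall x, g x x = 0) ->
  \sum_x \sum_y g x y =
  2 * \sum_x \sum_(y | (enum_rank x < enum_rank y)%N) g x y.
Proof.
move=> g_sym g_diag; rewrite mulr_natl mulr2n.
rewrite [X in _ = _ + X](exchange_big_dep predT) //= -big_split /=.
apply: eq_bigr => x _.
rewrite (bigID (fun y => (enum_rank x < enum_rank y)%N)) /=; congr (_ + _).
rewrite (bigD1 x) ?ltnn //= g_diag add0r.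
apply: eq_big => [y|y _]; last exact: g_sym.
rewrite -leqNgt leq_eqVlt andb_orl.
by rewrite -[_ == _ :> nat]/(enum_rank y == enum_rank x) (inj_eq enum_rank_inj);
  case: eqVneq => [->|_]; rewrite ?ltnn ?andbT.
Qed.

Lemma coupling_sym (x y : site d) : coupling R x y = coupling R y x.
Proof.
rewrite /coupling (_ : dist R x y = dist R y x) // /dist.
by congr Num.sqrt; apply: eq_bigr => i _; rewrite -opprB rmorphN sqrrN.
Qed.

Lemma coupling_diag (x : site d) : coupling R x x = 0.
Proof.
rewrite /coupling /dist big1 ?sqrtr0 1?eq_sym ?oner_eq0 // => i _.
by rewrite subrr expr0n.
Qed.

Lemma spinsE L (sigma : {ffun L -> bool}) (u : L) :
  spins R sigma (val u) = (-1) ^+ sigma u.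
Proof. by rewrite /spins valK. Qed.

Lemma expR_hamiltonian L beta (sigma : {ffun L -> bool}) :
  expR (- beta * hamiltonian L (spins R sigma)) =
  boltzmann (@volume_coupling L beta) sigma.
Proof.
rewrite boltzmannE; congr expR; rewrite /hamiltonian.
pose g (x y : L) : R :=
  coupling R (val x) (val y) * ((-1) ^+ sigma x * (-1) ^+ sigma y).
have -> : \sum_(x : L) \sum_(y : L | (enum_rank x < enum_rank y)%N)
    coupling R (val x) (val y) * spins R sigma (val x) * spins R sigma (val y)
    = 2^-1 * \sum_x \sum_y g x y.
  rewrite sum_ordered_pairs ?mulKf ?pnatr_eq0 //.
  - apply: eq_bigr => x _; apply: eq_bigr => y _.
    by rewrite !spinsE /g mulrA.
  - by move=> x y; rewrite /g coupling_sym [_ ^+ _ * _]mulrC.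
  - by move=> x; rewrite /g coupling_diag mul0r.
rewrite pair_big /= mulrNN [LHS]mulrA [LHS]mulrA mulr_sumr.
apply: eq_bigr => -[x y] _.
rewrite chi_endpoint /volume_coupling /g [val _.1]/= [val _.2]/=.
move: (coupling _ _ _) (_ * _ ^+ _) => J s.
by field.
Qed.

Lemma gibbs_corr L beta (f : (site d -> R) -> R) (b : L -> bool) :
    (forall sigma : {ffun L -> bool}, f (spins R sigma) = chi sigma b) ->
  gibbs L (hamiltonian L) beta f = corr (@volume_coupling L beta) b.
Proof.
move=> fE; rewrite /gibbs /tr /corr moment0E invf_div mulrA divfK; last first.
  by rewrite expf_neq0 // pnatr_eq0.
congr (_ / _); last by apply: eq_bigr => sigma _; exact: expR_hamiltonian.
by apply: eq_bigr => sigma _; rewrite fE expR_hamiltonian.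
Qed.

Lemma perm_fsub A L : (A `<=` L)%fset ->
  perm_eq [seq val u | u <- enum [set u : L | val u \in A]] (enum_fset A).
Proof.
move=> /fsubsetP AL; apply: uniq_perm.
- by rewrite (map_inj_uniq val_inj) enum_uniq.
- exact: fset_uniq.
move=> x; apply/mapP/idP => [[u]|xA]; first by rewrite mem_enum inE => ? ->.
by exists [` AL x xA]%fset; rewrite // mem_enum inE.
Qed.

Lemma spin_prod_chi A L (sigma : {ffun L -> bool}) : (A `<=` L)%fset ->
  spin_prod A (spins R sigma) = chi sigma (mem A \o val).
Proof.
move=> AL; rewrite /spin_prod -(perm_big _ (perm_fsub AL)) big_map big_enum /=.
rewrite (eq_bigr _ (fun u _ => spinsE sigma u)) -chi_mem.
by apply: eq_chi => u /=; rewrite inE.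
Qed.

Definition volume_corr L beta (b : pred (site d)) : R :=
  corr (@volume_coupling L beta) (b \o val).

Lemma volume_corr_le L L' beta (b : pred (site d)) : 0 <= beta ->
    (L `<=` L')%fset -> (forall x, b x -> x \in L) ->
  volume_corr L beta b <= volume_corr L' beta b.
Proof.
move=> beta0 LL' bL.
apply: (@corr_embed_le _ _ _ (fincl LL') _ (@volume_coupling L' beta)) => //.
- exact: fincl_inj.
- by move=> e; exact: volume_coupling_ge0.
- move=> w; apply: contraNF => /bL wL; apply/codomP; exists [` wL]%fset.
  exact: val_inj.
Qed.

End FiniteVolume.

(** * Infinite-volume correlations as suprema *)

Section Limit.
Context {R : realType}.

(** Monotone convergence along finite sets, with conditions only beyond [A]: correlations are
    compared once the volume contains their support. *)
Lemma cvg_totally_sup (T : choiceType) (F : {fset T} -> R) (A : {fset T}) M :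
    (forall L L', A `<=` L -> L `<=` L' -> F L <= F L')%fset ->
    (forall L, A `<=` L -> F L <= M)%fset ->
  (F @ totally --> sup [set F L | L in [set L | A `<=` L]%fset])%classic.
Proof.
move=> F_nd F_le; set E := (X in sup X).
have E_sup : has_sup E.
  split; first by exists (F A), A => //=; exact: fsubset_refl.
  by exists M => _ [L /= AL <-]; exact: F_le.
have totallyF : ProperFilter (@totally T) := totally_filter.
apply/cvgrPdist_le => e e0.
have [_ [L0 /= AL0 <-] ltL0] := sup_adherent e0 E_sup.
exists L0 => // L /= L0L; have AL := fsubset_trans AL0 L0L.
have FL : F L <= sup E by apply: ub_le_sup; [exact: E_sup.2|exists L].
rewrite ger0_norm ?subr_ge0 // lerBlDr -lerBlDl.
exact: le_trans (ltW ltL0) (F_nd _ _ AL0 L0L).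
Qed.

Context {d : nat} (beta : R) (f : (site d -> R) -> R) (b : pred (site d)).
Variable A : {fset site d}.
Hypotheses (beta0 : 0 <= beta) (bA : forall x, b x -> x \in A)
  (fE : forall L, (A `<=` L)%fset ->
     forall sigma : {ffun L -> bool}, f (spins R sigma) = chi sigma (b \o val)).

(** As a supremum, the limit passes the assumed decay of pairs down to finite volumes and uniform
    finite-volume bounds up to infinite volume. *)
Lemma ising_sup : ising beta f =
  sup [set volume_corr L beta b | L in [set L | A `<=` L]%fset]%classic.
Proof.
set E := (X in sup X).
have -> : E = [set gibbs L (hamiltonian L) beta f
                 | L in [set L | A `<=` L]%fset]%classic.
  rewrite /E; apply: eq_imagel => L /= AL.
  by rewrite (gibbs_corr _ (fE AL)).
have totallyF : ProperFilter (@totally (site d)) := totally_filter.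
apply: cvg_lim => //; apply: (@cvg_totally_sup _ _ A 1) => [L L' AL LL'|L AL].
  rewrite (gibbs_corr _ (fE AL)) (gibbs_corr _ (fE (fsubset_trans AL LL'))).
  apply: volume_corr_le => // x /bA; exact: (fsubsetP AL).
by rewrite (gibbs_corr _ (fE AL)) corr_le1.
Qed.

Lemma volume_corr_le_ising L : (A `<=` L)%fset ->
  volume_corr L beta b <= ising beta f.
Proof.
move=> AL; rewrite ising_sup; apply: ub_le_sup; last by exists L.
by exists 1 => _ [L' _ <-]; exact: corr_le1.
Qed.

Lemma ising_le M : (forall L, (A `<=` L)%fset -> volume_corr L beta b <= M) ->
  ising beta f <= M.
Proof.
move=> leM; rewrite ising_sup; apply: ge_sup.
  by exists (volume_corr A beta b), A => //=; exact: fsubset_refl.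
by move=> _ [L /= AL <-]; exact: leM.
Qed.

End Limit.

Theorem theorem2p2 (R : realType) (d : nat) (hd : (2 <= d)%N)
    (mu : R) (hmu : 0 < mu) :
  exists C : R, 0 < C /\
    forall beta : R, 0 <= beta -> beta < beta_c R d ->
    (forall x y : site d,
        ising beta (fun s : site d -> R => s x * s y)
          <= expR (- mu * dist R x y)) ->
    forall (n : nat) (A : {fset site d}), (1 <= n)%N -> #|` A| = (2 * n)%N ->
      ising beta (@spin_prod R d A)
        <= C ^+ n * expR (- (mu / (2 * Num.sqrt d%:R)) * Ds R A).
Proof.
have d0 : (0 < d)%N by exact: ltn_trans hd.
(* [c] is the half of the decay that is kept, and [K] bounds the lattice sum of the other half;
   neither depends on [beta]. *)
pose c : R := mu / 2; have c0 : 0 < c by rewrite divr_gt0.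
pose K : R := (2 / (1 - expR (- (c / d%:R)))) ^+ d.
have K0 : 0 < K.
  rewrite exprn_gt0 // divr_gt0 // subr_gt0 expR_lt1 oppr_lt0.
  by rewrite divr_gt0 // ltr0n.
exists K; split=> // beta beta0 _ pair_decay n A _ cardA.
have decay : ising beta (@spin_prod R d A) <= K ^+ n * expR (- c * Ds R A).
  apply: (@ising_le _ _ _ _ (mem A) A) => // [L AL sigma|L AL].
    exact: spin_prod_chi.
  have permA := perm_fsub AL.
  rewrite /volume_corr (eq_corr _ (b' := mem [set u : L | val u \in A]));
    last by move=> u /=; rewrite inE.
  apply: (corr_decay (dst := fun u v : L => dist R (val u) (val v))) => //.
  - by move=> e; exact: volume_coupling_ge0.
  - exact: ltW.
  - move=> u v uv; rewrite /c mulrCA divff ?mulr1 //.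
    apply: le_trans (pair_decay (val u) (val v)).
    (* The pair becomes a predicate on the whole lattice, which makes sense in every volume. *)
    pose b (x : site d) := (x == val u) (+) (x == val v).
    rewrite (eq_corr _ (b' := b \o val)) -/(volume_corr L beta b); last first.
      by move=> w; rewrite /endpoint /b /= !val_eqE.
    apply: (@volume_corr_le_ising _ _ _ _ _ [fset val u; val v]%fset) => //.
    + by move=> x; rewrite /b !inE; do 2 case: (_ == _).
    + move=> L' /fsubsetP uvL' sigma.
      have uL' : val u \in L' by apply: uvL'; rewrite !inE eqxx.
      have vL' : val v \in L' by apply: uvL'; rewrite !inE eqxx orbT.
      rewrite (spinsE sigma [` uL']%fset) (spinsE sigma [` vL']%fset).
      by rewrite -chi_endpoint; apply: eq_chi => w; rewrite /endpoint -!val_eqE.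
    + by apply/fsubsetP => x; rewrite !inE => /orP[] /eqP ->; exact: valP.
  - move=> u; apply: le_trans (sum_expR_dist_le (val u) d0 c0 (fset_uniq L)).
    by rewrite big_seq_fsetE.
  - by rewrite -cardA -(perm_size permA) size_map cardE.
  - move=> pl plB.
    (* Seen in the lattice, a pairing of the sites of [L] lying in [A] is a pairing of [A]. *)
    apply: (le_trans (Ds_le (pl := [seq (val p.1, val p.2) | p <- pl]) _)).
      rewrite -(permPr permA); have := perm_map val plB.
      by rewrite map_flatten -!map_comp.
    by rewrite big_map.
apply: le_trans decay _; apply: ler_wpM2l; first exact/exprn_ge0/ltW.
(* The claimed rate is at most [c], because [sqrt d >= 1]. *)
rewrite ler_expR !mulNr lerN2 ler_wpM2r ?Ds_ge0 //.
rewrite /c ler_wpM2l ?(ltW hmu) //.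
rewrite lef_pV2 ?posrE ?mulr_gt0 ?sqrtr_gt0 ?ltr0n //.
by rewrite ler_peMr // -[leLHS]sqrtr1 ler_sqrt ?ler1n ?ler0n.
Qed.
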